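(* For every positive integer $n$, the following identity holds in the ring of formal power series $\mathbb{Z}[[z_0,z_1,\ldots,z_n]]$: \[ \sum_{ k \ge 0 } \prod_{ j=1 }^n [k+1]_{ z_j } \, z_0^k \ = \ \sum_{ \pi \in S_n } \frac{ \prod_{ j \in \mathrm{Des}(\pi) } z_0z_{ \pi(1) } z_{ \pi(2) } \cdots z_{ \pi(j) } }{ \prod_{ j=0 }^n \left( 1 - z_0 \, z_{ \pi(1) } z_{ \pi(2) } \cdots z_{ \pi(j) } \right) } \, , \] where for $j=0$ the factor in the denominator is $1-z_0$.
   Context: $S_n$ is the symmetric group of permutations of $[n]=\{1,\ldots,n\}$. For $\pi\in S_n$, the descent set is $\mathrm{Des}(\pi)=\{j\in[n-1]:\pi(j)>\pi(j+1)\}$. For a variable $z$ and integer $m\ge 0$, $[m]_z = 1+z+\cdots+z^{m-1}$ (so $[0]_z=0$). *)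

(* Defs.v *)
From HB Require Import structures.
From mathcomp Require Import all_boot all_order all_fingroup all_algebra.
From mathcomp Require Import boolp.
From mathcomp Require Import mpoly.

Set Implicit Arguments.
Unset Strict Implicit.
Unset Printing Implicit Defensive.

Import GRing.Theory.
Local Open Scope ring_scope.

(* R[[z_0, ..., z_(n-1)]]: a series is its family of coefficients, indexed by
   the exponent vectors 'X_{1..n} of the multinomials library. *)
Record mfps (n : nat) (R : comNzRingType) :=
  MFps { mfps_coef : 'X_{1..n} -> R }.

HB.instance Definition _ n R := gen_eqMixin (mfps n R).
HB.instance Definition _ n R := gen_choiceMixin (mfps n R).

Section MFpsRing.
Variables (n : nat) (R : comNzRingType).
Implicit Types (f g h : mfps n R) (m : 'X_{1..n}).

Lemma mfpsP f g : mfps_coef f =1 mfps_coef g -> f = g.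
Proof. by case: f => f; case: g => g /= fg; congr MFps; apply/funext. Qed.

Definition mfps_zero : mfps n R := MFps (fun=> 0).
Definition mfps_opp f := MFps (fun m => - mfps_coef f m).
Definition mfps_add f g := MFps (fun m => mfps_coef f m + mfps_coef g m).

Fact mfps_addA : associative mfps_add.
Proof. by move=> f g h; apply: mfpsP => m /=; rewrite addrA. Qed.
Fact mfps_addC : commutative mfps_add.
Proof. by move=> f g; apply: mfpsP => m /=; rewrite addrC. Qed.
Fact mfps_add0 : left_id mfps_zero mfps_add.
Proof. by move=> f; apply: mfpsP => m /=; rewrite add0r. Qed.
Fact mfps_addN : left_inverse mfps_zero mfps_opp mfps_add.
Proof. by move=> f; apply: mfpsP => m /=; rewrite addNr. Qed.

HB.instance Definition _ := GRing.isZmodule.Build (mfps n R)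
  mfps_addA mfps_addC mfps_add0 mfps_addN.

Definition mfps_one : mfps n R := MFps (fun m => (m == 0%MM)%:R).

(* Cauchy product: the pairs of exponents (k.1, k.2) with k.1 + k.2 = m are
   enumerated among those of total degree at most mdeg m, as in mcoeffM. *)
Definition mfps_mul f g : mfps n R := MFps (fun m =>
  \sum_(k : 'X_{1..n < (mdeg m).+1, (mdeg m).+1} | m == (k.1 + k.2)%MM)
    mfps_coef f k.1 * mfps_coef g k.2).

Definition mfps_trunc (d : nat) f : {mpoly R[n]} :=
  \sum_(m : 'X_{1..n < d}) mfps_coef f m *: 'X_[m].

Lemma mcoeff_trunc d f m :
  (mdeg m < d)%N -> (mfps_trunc d f)@_m = mfps_coef f m.
Proof. exact: mcoeff_mpoly. Qed.

Lemma eq_mcoeffM (p p' q q' : {mpoly R[n]}) m :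
    (forall k, (mdeg k <= mdeg m)%N -> p@_k = p'@_k) ->
    (forall k, (mdeg k <= mdeg m)%N -> q@_k = q'@_k) ->
  (p * q)@_m = (p' * q')@_m.
Proof.
move=> pp' qq'; rewrite !mcoeffM; apply: eq_bigr => k _.
by rewrite pp' ?qq' // -ltnS bmdeg.
Qed.

Lemma mfps_coef_mul d f g m : (mdeg m < d)%N ->
  mfps_coef (mfps_mul f g) m = (mfps_trunc d f * mfps_trunc d g)@_m.
Proof.
move=> ltmd; rewrite mcoeffM /=; apply: eq_bigr => k _.
by rewrite !mcoeff_trunc // (leq_trans (bmdeg _)).
Qed.

Fact mfps_mulA : associative mfps_mul.
Proof.
move=> f g h; apply: mfpsP => m; rewrite !(mfps_coef_mul _ _ (ltnSn _)).
set d := (mdeg m).+1.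
transitivity ((mfps_trunc d f * (mfps_trunc d g * mfps_trunc d h))@_m).
  apply: eq_mcoeffM => // k le_km; rewrite mcoeff_trunc ?ltnS //.
  exact: mfps_coef_mul.
rewrite mulrA; apply: eq_mcoeffM => // k le_km; rewrite mcoeff_trunc ?ltnS //.
exact/esym/mfps_coef_mul.
Qed.

Fact mfps_mulC : commutative mfps_mul.
Proof.
by move=> f g; apply: mfpsP => m; rewrite !(mfps_coef_mul _ _ (ltnSn _)) mulrC.
Qed.

Fact mfps_mul1 : left_id mfps_one mfps_mul.
Proof.
move=> f; apply: mfpsP => m; rewrite (mfps_coef_mul _ _ (ltnSn _)).
rewrite -[RHS](mcoeff_trunc _ (ltnSn (mdeg m))) -[in RHS](mul1r (mfps_trunc _ f)).
by apply: eq_mcoeffM => // k le_km; rewrite mcoeff_trunc ?ltnS // mcoeff1.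
Qed.

Fact mfps_mulDl : left_distributive mfps_mul mfps_add.
Proof.
move=> f g h; apply: mfpsP => m; rewrite /= -big_split /=.
by apply: eq_bigr => k _; rewrite mulrDl.
Qed.

Fact mfps_oner_neq0 : mfps_one != 0.
Proof.
apply/eqP => /(congr1 (fun f => mfps_coef f 0%MM)) /= /eqP.
by rewrite eqxx oner_eq0.
Qed.

HB.instance Definition _ := GRing.Zmodule_isComNzRing.Build (mfps n R)
  mfps_mulA mfps_mulC mfps_mul1 mfps_mulDl mfps_oner_neq0.

Definition mfps_unit : pred (mfps n R) := fun f => `[< exists g, g * f = 1 >].

Definition mfps_inv f : mfps n R :=
  if pselect (exists g, g * f = 1) is left ex then projT1 (cid ex) else f.

Fact mfps_mulVr : {in mfps_unit, left_inverse 1 mfps_inv *%R}.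
Proof.
move=> f /asboolP uf; rewrite /mfps_inv.
by case: pselect => // ex; case: cid.
Qed.
Fact mfps_unitP f g : g * f = 1 -> mfps_unit f.
Proof. by move=> gf; apply/asboolP; exists g. Qed.
Fact mfps_inv_out : {in [predC mfps_unit], mfps_inv =1 id}.
Proof.
by move=> f /asboolP nuf; rewrite /mfps_inv; case: pselect.
Qed.

HB.instance Definition _ := GRing.ComNzRing_hasMulInverse.Build (mfps n R)
  mfps_mulVr mfps_unitP mfps_inv_out.

Definition mfps_var (i : 'I_n) : mfps n R := MFps (fun m => (m == U_(i)%MM)%:R).

(* Convergence of an infinite sum of formal power series: every coefficient of
   the partial sums is eventually constant, with value that of s. *)
Definition mfps_sums_to (u : nat -> mfps n R) (s : mfps n R) : Prop :=
  forall m : 'X_{1..n}, exists N : nat, forall K : nat, (N <= K)%N ->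
    mfps_coef (\sum_(k < K) u k) m = mfps_coef s m.

Lemma mfps_coefD f g m : mfps_coef (f + g) m = mfps_coef f m + mfps_coef g m.
Proof. by []. Qed.

Lemma mfps_coefM f g m : mfps_coef (f * g) m =
  \sum_(k : 'X_{1..n < (mdeg m).+1, (mdeg m).+1} | m == (k.1 + k.2)%MM)
    mfps_coef f k.1 * mfps_coef g k.2.
Proof. by []. Qed.

Lemma mfps_coef_sum I (r : seq I) (P : pred I) (F : I -> mfps n R) m :
  mfps_coef (\sum_(i <- r | P i) F i) m = \sum_(i <- r | P i) mfps_coef (F i) m.
Proof. exact: (big_morph (fun f => mfps_coef f m) (fun f g => mfps_coefD f g m)). Qed.

Lemma mfps_coefX_small f (k : nat) m : mfps_coef f 0%MM = 0 ->
  (mdeg m < k)%N -> mfps_coef (f ^+ k) m = 0.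
Proof.
move=> f0; elim: k m => // k IHk m ltmk; rewrite exprS.
rewrite mfps_coefM big1 // => -[k1 k2] /= /eqP /(congr1 mdeg).
rewrite mdegD => m_def.
have [->|k1n0] := eqVneq (k1 : 'X_{1..n}) 0%MM; first by rewrite f0 mul0r.
rewrite IHk ?mulr0 //; rewrite -ltnS; apply: leq_trans ltmk.
by rewrite ltnS [X in (_ <= X)%N]m_def -[X in (X < _)%N]add0n ltn_add2r lt0n mdeg_eq0.
Qed.

(* The denominators 1 - z_0 z_pi(1) ... z_pi(j) are genuinely invertible. *)
Lemma mfps_1B_unit f : mfps_coef f 0%MM = 0 -> 1 - f \is a GRing.unit.
Proof.
move=> f0; apply: (@mfps_unitP _
  (MFps (fun m => mfps_coef (\sum_(i < (mdeg m).+1) f ^+ i) m))).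
set g := MFps _; apply: mfpsP => m.
have -> : mfps_coef (g * (1 - f)) m =
          mfps_coef ((\sum_(i < (mdeg m).+1) f ^+ i) * (1 - f)) m.
  rewrite !mfps_coefM; apply: eq_bigr => k /eqP m_def; congr (_ * _); rewrite /g /= !mfps_coef_sum.
  have le_km : ((mdeg k.1).+1 <= (mdeg m).+1)%N by rewrite bmdeg.
  rewrite -!(big_mkord xpredT (fun i => mfps_coef (f ^+ i) k.1)).
  rewrite [RHS](big_cat_nat (leq0n _) le_km) /= [X in _ = _ + X]big_nat [X in _ = _ + X]big1 ?addr0 // => i.
  by case/andP => lt_ki _; apply: mfps_coefX_small.
rewrite mulrC -[in LHS](opprB f 1) mulNr -subrX1 opprB mfps_coefD /=.
by rewrite [mfps_coef (f ^+ _) _]mfps_coefX_small // oppr0 addr0.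
Qed.

End MFpsRing.

Notation "''z_' i" := (mfps_var int i)
  (at level 8, i at level 2, format "''z_' i") : ring_scope.

(* [k]_z *)
Definition qnum (A : comNzRingType) (k : nat) (z : A) : A := \sum_(i < k) z ^+ i.

(* Positions and values of pi : 'S_n are numbered from 0, so the textbook
   pi(j), pi(j+1) are the images of the ordinals of value j-1, j; the element
   j : 'I_n of Des pi below is the textbook descent position, in 1, ..., n-1. *)
Definition Des (n : nat) (pi : 'S_n) : {set 'I_n} :=
  [set j : 'I_n | [exists i : 'I_n, (i.+1 == j :> nat) && (pi j < pi i)%N]].

(* z_0 z_pi(1) ... z_pi(j): the variable z_v of the textbook value v = w+1,
   w : 'I_n, has index lift ord0 w : 'I_n.+1. *)
Definition zprod (n : nat) (pi : 'S_n) (j : nat) : mfps n.+1 int :=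
  'z_ord0 * \prod_(i < n | (i < j)%N) 'z_(lift ord0 (pi i)).

(* Main.v *)
Require Import Defs.
From HB Require Import structures.
From mathcomp Require Import all_boot all_order all_fingroup all_algebra.
From mathcomp Require Import boolp.
From mathcomp Require Import mpoly.
From mathcomp Require Import zify.

(* Both sides are the generating function of the exponent vectors m with
   m_j <= m_0 for all j.  On the left this is the expansion of the product of
   q-numbers.  On the right, the summand of pi generates the m with
   m_0 >= m_pi(1) >= ... >= m_pi(n) >= 0 where the inequality is strict at each
   descent of pi: the exponents of z_0 z_pi(1) ... z_pi(j), 0 <= j <= n, form a
   basis in which this set is a translated orthant.  Each m with m_j <= m_0
   belongs to exactly one of these sets, pi being the permutation that sorts m
   decreasingly and breaks ties by increasing index. *)

Set Implicit Arguments.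
Unset Strict Implicit.
Unset Printing Implicit Defensive.

Import GRing.Theory.
Local Open Scope ring_scope.

(** * Monomials as power series *)

Section Monomials.
Variables (n : nat) (R : comNzRingType).
Implicit Types (m e : 'X_{1..n}) (f : mfps n R).

Definition mfps_monom e : mfps n R := MFps (fun m => (m == e)%:R).

Lemma mfps_coef_monomM e f m :
  mfps_coef (mfps_monom e * f) m =
  if (e <= m)%MM then mfps_coef f (m - e)%MM else 0.
Proof.
rewrite mfps_coefM; case: ifPn => [le_em | nle_em].
  have lte : (mdeg e < (mdeg m).+1)%N.
    by rewrite ltnS -(submK le_em) mdegD leq_addl.
  have ltB : (mdeg (m - e)%MM < (mdeg m).+1)%N by rewrite ltnS mdegB.
  rewrite (bigD1 (BMultinom lte, BMultinom ltB)) /=; last first.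
    by rewrite addmC submK.
  rewrite eqxx mul1r big1 ?addr0 // => -[k1 k2] /= /andP[/eqP m_def neq].
  case: eqVneq => [k1e|]; last by rewrite mul0r.
  case/negP: neq; rewrite xpair_eqE !bmeqP /= k1e eqxx /=.
  by rewrite [X in (X - e)%MM]m_def k1e addmC addmK.
rewrite big1 // => -[k1 k2] /= /eqP m_def.
case: eqVneq => [k1e|]; last by rewrite mul0r.
by case/negP: nle_em; rewrite m_def k1e lem_addr.
Qed.

Lemma mfps_monom0 : mfps_monom 0%MM = 1.
Proof. exact: mfpsP. Qed.

Lemma mfps_monomD e1 e2 :
  mfps_monom (e1 + e2)%MM = mfps_monom e1 * mfps_monom e2.
Proof.
apply: mfpsP => m; rewrite mfps_coef_monomM /=.
case: ifPn => [le_em | nle_em].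
  congr (nat_of_bool _)%:R; apply/eqP/eqP => [->|<-].
    by rewrite addmC addmK.
  by rewrite addmC submK.
by case: eqVneq => // m_def; case/negP: nle_em; rewrite m_def lem_addr.
Qed.

Lemma mfps_monom_sum I (r : seq I) (P : pred I) (F : I -> 'X_{1..n}) :
  mfps_monom (\sum_(i <- r | P i) F i)%MM =
  \prod_(i <- r | P i) mfps_monom (F i).
Proof. exact: (big_morph _ mfps_monomD mfps_monom0). Qed.

Lemma mfps_monomX e k : mfps_monom e ^+ k = mfps_monom (e *+ k)%MM.
Proof.
elim: k => [|k IHk]; first by rewrite expr0 mulm0n mfps_monom0.
by rewrite exprS IHk -mfps_monomD mulmS.
Qed.

Lemma mfps_1Bmonom_unit e : e != 0%MM -> 1 - mfps_monom e \is a GRing.unit.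
Proof. by move=> e0; apply: mfps_1B_unit; rewrite /= eq_sym (negPf e0). Qed.

End Monomials.

(** * Exponent vectors read along a permutation *)

Section Chains.
Variables (n : nat) (pi : 'S_n).
Implicit Types (m : 'X_{1..n.+1}) (i j k : nat).

(* The sequence m_0, m_pi(1), ..., m_pi(n), continued by 0. *)
Definition chain m j : nat :=
  if j is i.+1 then oapp (fun i' : 'I_n => m (lift ord0 (pi i'))) 0%N (insub i)
  else m ord0.

Definition zexp j : 'X_{1..n.+1} :=
  (U_(ord0) + \sum_(i < n | (i < j)%N) U_(lift ord0 (pi i)))%MM.

Lemma zprod_monom j : zprod pi j = mfps_monom int (zexp j).
Proof. by rewrite /zprod mfps_monomD mfps_monom_sum. Qed.

Lemma chain_ord m (i : 'I_n) : chain m i.+1 = m (lift ord0 (pi i)).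
Proof. by rewrite /chain valK. Qed.

Lemma chain_out m j : (n < j)%N -> chain m j = 0%N.
Proof. by case: j => // j; rewrite ltnS leqNgt => lt; rewrite /= insubN. Qed.

Lemma chainD m1 m2 j : chain (m1 + m2)%MM j = (chain m1 j + chain m2 j)%N.
Proof. by case: j => [|j] /=; [|case: insub => [i|] //=]; rewrite mnmDE. Qed.

Lemma chain0 j : chain 0%MM j = 0%N.
Proof. by case: j => [|j] /=; [|case: insub => [i|] //=]; rewrite mnm0E. Qed.

Lemma chain_sum I (r : seq I) (P : pred I) (F : I -> 'X_{1..n.+1}) j :
  chain (\sum_(i <- r | P i) F i)%MM j = (\sum_(i <- r | P i) chain (F i) j)%N.
Proof.
by rewrite (big_morph (chain^~ j) (fun m1 m2 => chainD m1 m2 j) (chain0 j)).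
Qed.

Lemma chainMn m k j : chain (m *+ k)%MM j = (chain m j * k)%N.
Proof. by case: j => [|j] /=; [|case: insub => [i|] //=]; rewrite mulmnE. Qed.

Lemma chain_le m1 m2 :
  (m1 <= m2)%MM <-> (forall j, (chain m1 j <= chain m2 j)%N).
Proof.
split=> [/mnm_lepP le12 [|j] | le12] /=; first exact: le12.
  by case: insub => [i|] //=.
apply/mnm_lepP => i; case: (unliftP ord0 i) => [j ->|->]; last exact: (le12 0%N).
by have := le12 (pi^-1%g j).+1; rewrite !chain_ord permKV.
Qed.

Lemma chain_inj m1 m2 : chain m1 =1 chain m2 -> m1 = m2.
Proof.
move=> eq12; apply/mnmP => i.
by case: (unliftP ord0 i) => [j ->|->];
  [have := eq12 (pi^-1%g j).+1; rewrite !chain_ord permKV | exact: (eq12 0%N)].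
Qed.

(** Adding [zexp j] thus raises the drop from position [j] to [j.+1] by one and changes no other
    drop: the vectors [zexp j] are dual to the successive differences of the chain. *)
Lemma chain_zexp i j : (j <= n)%N -> chain (zexp j) i = (i <= j)%N.
Proof.
move=> le_jn; case: (ltnP n i) => [lt_ni | ].
  by rewrite chain_out // leqNgt (leq_ltn_trans le_jn).
case: i => [_|i lt_in].
  rewrite /= mnmDE mnm1E eqxx mnm_sumE big1 // => i _.
  by rewrite mnm1E.
rewrite (chain_ord _ (Ordinal lt_in)) mnmDE mnm1E /= mnm_sumE big_mkcond /=.
rewrite (bigD1 (Ordinal lt_in)) //= big1 => [|i' ne_i].
  by rewrite mnm1E eqxx addn0; case: ifP.
by rewrite mnm1E (inj_eq lift_inj) (inj_eq perm_inj) (negPf ne_i) if_same.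
Qed.

Lemma chainD_zexp m i k : (k <= n)%N ->
  chain (m + zexp k)%MM i = (chain m i + (i <= k))%N.
Proof. by move=> le_kn; rewrite chainD chain_zexp. Qed.

Lemma zexp_neq0 j : zexp j != 0%MM.
Proof.
apply/eqP => /mnmP /(_ ord0).
by rewrite mnmDE mnm1E eqxx mnm0E.
Qed.

(** * Faces of a translated orthant and their generating series *)

(* Membership in the translated orthant cut out by delta, with its first k
   inequalities turned into equalities. *)
Definition in_face (delta : nat -> nat) k m : bool :=
  [forall j : 'I_n.+1,
     if (j < k)%N then chain m j == (chain m j.+1 + delta j)%N
     else (chain m j.+1 + delta j <= chain m j)%N].

Lemma in_faceP delta k m :
  reflect (forall j, (j <= n)%N ->
             (chain m j.+1 + delta j <= chain m j)%N /\
             ((j < k)%N -> chain m j = (chain m j.+1 + delta j)%N))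
          (in_face delta k m).
Proof.
apply: (iffP forallP) => [H j le_jn | H j].
  have := H (Ordinal (le_jn : (j < n.+1)%N)) => /=.
  by case: ifP => [_ /eqP -> //|].
by have [le eq] := H j (ltn_ord j); case: ifP => // lt_jk; apply/eqP/eq.
Qed.

Definition face_series delta k : mfps n.+1 int :=
  MFps (fun m => (in_face delta k m)%:R).

(** The shift raises only the [k]-th drop. Afterwards inequality [k] is either tight, or strict, and
    then [m] satisfied it already. [in_face_disjoint] says that the two cases exclude each other. *)
Lemma in_face_shift delta k m : (k <= n)%N ->
  in_face delta k (m + zexp k)%MM =
  in_face delta k m || in_face delta k.+1 (m + zexp k)%MM.
Proof.
move=> le_kn.
have E j := chainD_zexp m j le_kn.
apply/in_faceP/orP => [H | [/in_faceP H | /in_faceP H] j le_jn].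
- have [eqk | neqk] :=
    eqVneq (chain (m + zexp k)%MM k) (chain (m + zexp k)%MM k.+1 + delta k)%N.
    right; apply/in_faceP => j le_jn; have [le eq] := H j le_jn; split=> //.
    by rewrite ltnS leq_eqVlt => /orP[/eqP ->|].
  left; apply/in_faceP => j le_jn; have [le eq] := H j le_jn.
  have [ejk | nejk] := eqVneq j k; first by move: le neqk; rewrite ejk !E; lia.
  by move: le eq; rewrite !E; lia.
- by have [le eq] := H j le_jn; rewrite !E; move: le eq; lia.
- by have [le eq] := H j le_jn; split=> // lt_jk; apply: eq; apply: ltnW.
Qed.

Lemma in_face_disjoint delta k m : (k <= n)%N ->
  in_face delta k m -> ~~ in_face delta k.+1 (m + zexp k)%MM.
Proof.
move=> le_kn /in_faceP H; apply/negP => /in_faceP H'.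
have [le _] := H k le_kn; have [_ /(_ (ltnSn k))] := H' k le_kn.
by rewrite !chainD_zexp //; lia.
Qed.

(** Slack at [k] would make the chain positive at every position up to [k], and [zexp k] would then
    lie below [m]. *)
Lemma in_face_nle delta k m : (k <= n)%N -> ~~ (zexp k <= m)%MM ->
  in_face delta k m = in_face delta k.+1 m.
Proof.
move=> le_kn nle; apply/idP/idP => /in_faceP H; apply/in_faceP => j le_jn;
  have [le eq] := H j le_jn; split=> // lt_jk; last exact/eq/ltnW.
have [ejk | nejk] := eqVneq j k; last by apply: eq; lia.
apply/eqP; rewrite eqn_leq le andbT leqNgt; apply/negP => lt.
case/negP: nle; apply/chain_le => i; rewrite chain_zexp //.
case: (leqP i k) => // le_ik; rewrite ejk in lt.
(* The chain is non-increasing and already positive at position k. *)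
suff : (chain m k <= chain m i)%N by lia.
elim: (k - i)%N {-2}i (erefl (k - i)%N) le_ik => [|d IHd] i' ed le_ik.
  by have -> : i' = k by lia.
have [le' _] := H i' (leq_trans le_ik le_kn).
have := IHd i'.+1; lia.
Qed.

(** The subtracted product is the series of the face translated by [zexp k]. By the three preceding
    lemmas, removing it leaves exactly the vectors with equality at [k]. *)
Lemma face_seriesS delta k : (k <= n)%N ->
  (1 - mfps_monom int (zexp k)) * face_series delta k = face_series delta k.+1.
Proof.
move=> le_kn; apply: mfpsP => m.
rewrite mulrBl mul1r mfps_coefD.
rewrite [mfps_coef (- _) _]/(- mfps_coef _ _) mfps_coef_monomM /=.
case: ifPn => [le_em | nle]; last by rewrite subr0 in_face_nle.
rewrite -{1 3}(submK le_em) in_face_shift //.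
have := @in_face_disjoint delta k (m - zexp k)%MM le_kn.
case: (in_face delta k (m - zexp k)%MM) => [/(_ isT)/negPf -> //|_ /=].
by rewrite subr0.
Qed.

Lemma face_series_denom delta k : (k <= n.+1)%N ->
  \prod_(j < k) (1 - mfps_monom int (zexp j)) * face_series delta 0 =
  face_series delta k.
Proof.
elim: k => [|k IHk] le_kn; first by rewrite big_ord0 mul1r.
by rewrite big_ord_recr /= mulrAC IHk 1?ltnW // mulrC face_seriesS.
Qed.

(** With all [n.+1] inequalities tight, the chain is determined backwards from its value 0 at
    position [n.+1], so this face is a single vector. *)
Lemma face_series_vertex delta :
  face_series delta n.+1 =
  \prod_(j < n.+1) mfps_monom int (zexp j) ^+ delta j.
Proof.
under eq_bigr do rewrite mfps_monomX.
rewrite -mfps_monom_sum; set v := (\sum_(i < _) _)%MM.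
have chain_v j : chain v j = (\sum_(i < n.+1) (j <= i) * delta i)%N.
  rewrite chain_sum; apply: eq_bigr => i _.
  by rewrite chainMn chain_zexp // -ltnS.
have chain_vS j : (j <= n)%N -> chain v j = (chain v j.+1 + delta j)%N.
  move=> le_jn; rewrite !chain_v.
  rewrite (bigD1 (Ordinal (le_jn : (j < n.+1)%N))) //= leqnn mul1n addnC.
  congr (_ + _)%N.
  rewrite [RHS](bigD1 (Ordinal (le_jn : (j < n.+1)%N))) //= ltnn mul0n add0n.
  by apply: eq_bigr => i ne_ij; rewrite [(j < i)%N]ltn_neqAle eq_sym ne_ij.
apply: mfpsP => m /=; congr (nat_of_bool _)%:R.
apply/in_faceP/eqP => [H | -> j le_jn]; last by rewrite (chain_vS j le_jn).
apply: chain_inj => j; case: (ltnP n j) => [lt|]; first by rewrite !chain_out.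
move=> le_jn.
elim: (n - j)%N {-2}j (erefl (n - j)%N) le_jn => [|d IHd] i ed le_in.
  have [_ ->] := H i le_in; last by rewrite ltnS.
  by rewrite chain_vS // !(@chain_out _ i.+1) //; lia.
have [_ ->] := H i le_in; last by rewrite ltnS.
by rewrite chain_vS // IHd //; lia.
Qed.

(** Each factor of the denominator tightens one inequality, so the whole denominator, a unit,
    carries the orthant to its vertex, which is the numerator. *)
Lemma face_seriesE (delta : nat -> nat) :
  (\prod_(j < n.+1) mfps_monom int (zexp j) ^+ delta j) /
  (\prod_(j < n.+1) (1 - mfps_monom int (zexp j))) = face_series delta 0.
Proof.
rewrite -face_series_vertex -face_series_denom // mulrC mulKr //.
by apply: rpred_prod => j _; exact/mfps_1Bmonom_unit/zexp_neq0.
Qed.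

(** Extended by false from [n] on, so that the last inequality, between m_pi(n) and 0, is never
    strict. *)
Definition descent j : bool :=
  oapp (fun i : 'I_n => i \in Des pi) false (insub j).

Lemma prod_Des :
  \prod_(j in Des pi) zprod pi j =
  \prod_(j < n.+1) mfps_monom int (zexp j) ^+ descent j.
Proof.
rewrite big_ord_recr /= {2}/descent insubN ?ltnn //= mulr1 big_mkcond /=.
apply: eq_bigr => j _; rewrite zprod_monom /descent valK /=.
by case: (j \in Des pi).
Qed.

Lemma descent0 : descent 0 = false.
Proof.
rewrite /descent; case: insubP => //= i _ i0.
by rewrite inE; apply/existsP => -[j]; rewrite i0.
Qed.

Lemma descentS (i j : 'I_n) : i.+1 = j -> descent j = (pi j < pi i)%N.
Proof.
move=> ij; rewrite /descent valK /= inE.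
apply/existsP/idP => [[i' /andP[/eqP i'j]] | lt].
  by have -> : i' = i by apply: val_inj => /=; lia.
by exists i; rewrite ij eqxx.
Qed.

End Chains.

(** * The sorting permutation of an exponent vector *)

Lemma exists_unique_sorting_perm n (r : rel 'I_n) :
  total r -> transitive r -> antisymmetric r ->
  exists pi0 : 'S_n, forall pi : 'S_n,
    (forall i j : 'I_n, i.+1 = j -> r (pi i) (pi j)) <-> pi = pi0.
Proof.
move=> r_tot r_tr r_anti.
(* The one-line word of [pi], spelled through [ord_tuple] so that [tuple_permP] applies. *)
pose t (pi : 'S_n) := [tuple tnth (ord_tuple n) (pi i) | i < n].
have t_perm pi : perm_eq (t pi) (ord_tuple n) by apply/tuple_permP; exists pi.
have t_nth pi (i x : 'I_n) : nth x (t pi) i = pi i.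
  by rewrite -tnth_nth tnth_mktuple tnth_ord_tuple.
have t_sorted pi :
    sorted r (t pi) <-> (forall i j : 'I_n, i.+1 = j -> r (pi i) (pi j)).
  split=> [srt i j ij | H].
    have /(sortedP i) := srt; rewrite size_tuple => /(_ i); rewrite ij.
    by move/(_ (ltn_ord j)); rewrite !t_nth.
  (* [sortedP] takes a default element of ['I_n], hence the separate case n = 0. *)
  case: n r pi {r_tot r_tr r_anti t_perm} @t t_nth H => [|n] r pi t t_nth H.
    by rewrite (tuple0 (t pi)).
  apply/(sortedP ord0) => i; rewrite size_tuple => ltSi.
  rewrite (t_nth pi (Ordinal (ltnW ltSi))) (t_nth pi (Ordinal ltSi)).
  exact: H.
have : perm_eq (sort r (ord_tuple n)) (ord_tuple n) by rewrite perm_sort.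
case/tuple_permP => pi0 def_pi0.
have srt0 : sorted r (t pi0) by rewrite /t -def_pi0 sort_sorted.
exists pi0 => pi; rewrite -t_sorted; split=> [srt | -> //].
(* Uniqueness: two sorted rearrangements of one word coincide, [r] being transitive and
   antisymmetric. *)
have eq_t : t pi = t pi0 :> seq _.
  apply: (sorted_eq r_tr r_anti srt srt0).
  by rewrite (perm_trans (t_perm pi)) // perm_sym.
by apply/permP => i; rewrite -!(t_nth _ i i) eq_t.
Qed.

Lemma face_head_max n (pi : 'S_n) delta m :
  in_face pi delta 0 m -> forall j : 'I_n, (m (lift ord0 j) <= m ord0)%N.
Proof.
move=> /in_faceP H j; rewrite -(permKV pi j) -chain_ord.
elim: (pi^-1%g j).+1 (ltn_ord (pi^-1%g j)) => // i IHi lt_in.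
have [le _] := H i (ltnW lt_in).
have := IHi (ltnW lt_in); lia.
Qed.

Lemma exists_unique_descent_face n (m : 'X_{1..n.+1}) :
  exists pi0 : 'S_n, forall pi : 'S_n,
    in_face pi (descent pi) 0 m =
    (pi == pi0) && [forall j : 'I_n, (m (lift ord0 j) <= m ord0)%N].
Proof.
pose M (a : 'I_n) := m (lift ord0 a).
(* A total order: larger entries of [m] first, ties by increasing index. The summand [(b < a)]
   demands strictness exactly where [a] followed by [b] is a descent. *)
pose r : rel 'I_n := fun a b => (M b + (b < a) <= M a)%N.
have r_tot : total r by move=> a b; rewrite /r; lia.
have r_tr : transitive r by move=> b a c; rewrite /r; lia.
have r_anti : antisymmetric r.
  by move=> a b; rewrite /r => H; apply: val_inj => /=; lia.
have [pi0 pi0P] := exists_unique_sorting_perm r_tot r_tr r_anti.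
exists pi0 => pi; apply/idP/andP => [Hf | [/eqP def_pi /forallP max0]].
  split; last by apply/forallP => j; apply: (face_head_max Hf).
  apply/eqP/pi0P => i j ij; have /in_faceP := Hf.
  move=> /(_ j (ltnW (ltn_ord j))) [le _]; move: le.
  by rewrite (descentS pi ij) /r /M -!chain_ord ij.
apply/in_faceP => j le_jn; split=> //.
have := (pi0P pi).2 def_pi => srt.
(* Only the inner positions use sortedness: position 0 uses the maximality of m_0, and position [n]
   compares with 0. *)
case: j le_jn => [|j] le_jn.
  rewrite descent0 addn0; case: (posnP n) => [n0|n_gt0].
    by rewrite chain_out // n0.
  by rewrite (chain_ord _ _ (Ordinal n_gt0)) /=.
move: le_jn; rewrite leq_eqVlt => /orP[/eqP ejn | ltjn].
  by rewrite chain_out ?ejn // /descent insubN ?ltnn.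
have ltj := ltnW ltjn.
rewrite (chain_ord _ _ (Ordinal ltj)) (chain_ord _ _ (Ordinal ltjn)).
rewrite (@descentS _ pi (Ordinal ltj) (Ordinal ltjn)) //.
exact: srt.
Qed.

(** * Expansion of the product of q-numbers *)

Lemma mfps_coef_qnum_prod n k (m : 'X_{1..n.+1}) :
  mfps_coef ((\prod_(j < n) qnum k.+1 'z_(lift ord0 j)) * 'z_ord0 ^+ k) m =
  ((m ord0 == k) && [forall j : 'I_n, (m (lift ord0 j) <= k)%N])%:R.
Proof.
(* Choosing the power [f j] in the [j]-th q-number gives the monomial [e f]. By [e0] and [eS], [k]
   and [f] can be read off from it, so no monomial repeats. *)
pose e (f : {ffun 'I_n -> 'I_k.+1}) : 'X_{1..n.+1} :=
  (\sum_(j < n) U_(lift ord0 j) *+ f j + U_(ord0) *+ k)%MM.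
have e0 f : e f ord0 = k.
  rewrite mnmDE mulmnE mnm1E eqxx mul1n mnm_sumE big1 // => j _.
  by rewrite mulmnE mnm1E.
have eS f j : e f (lift ord0 j) = f j.
  rewrite mnmDE mulmnE mnm1E mul0n addn0 mnm_sumE (bigD1 j) //= big1 => [|i ne].
    by rewrite mulmnE mnm1E eqxx mul1n addn0.
  by rewrite mulmnE mnm1E (inj_eq lift_inj) (negPf ne).
have -> : (\prod_(j < n) qnum k.+1 'z_(lift ord0 j)) * 'z_ord0 ^+ k =
          \sum_(f : {ffun 'I_n -> 'I_k.+1}) mfps_monom int (e f).
  rewrite /qnum bigA_distr_bigA mulr_suml; apply: eq_bigr => f _.
  rewrite mfps_monomD mfps_monom_sum -mfps_monomX; congr (_ * _).
  by apply: eq_bigr => j _; rewrite -mfps_monomX.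
rewrite mfps_coef_sum /=; case: andP => [[/eqP m0 /forallP mS] | H].
  pose f0 := [ffun j : 'I_n => inord (m (lift ord0 j)) : 'I_k.+1].
  have def_m : m = e f0.
    apply/mnmP => i; case: (unliftP ord0 i) => [j ->|->]; last by rewrite e0.
    by rewrite eS ffunE inordK // ltnS.
  rewrite (bigD1 f0) //= {1}def_m eqxx big1 ?addr0 // => f ne_f.
  case: eqVneq => // mf; case/eqP: ne_f; apply/ffunP => j; apply: val_inj => /=.
  by rewrite -eS -mf def_m eS.
rewrite big1 // => f _; case: eqVneq => // mf; case: H; split.
  by rewrite mf e0.
by apply/forallP => j; rewrite mf eS -ltnS.
Qed.

Theorem theorem4p1 (n : nat) (n_gt0 : (0 < n)%N) :
  mfps_sums_to
    (fun k : nat =>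
       (\prod_(j < n) qnum k.+1 'z_(lift ord0 j)) * ('z_ord0 : mfps n.+1 int) ^+ k)
    (\sum_(pi : 'S_n)
       (\prod_(j in Des pi) zprod pi j) / (\prod_(j < n.+1) (1 - zprod pi j))).
Proof.
(* Only the term k = m_0 can contribute to the coefficient at [m], so the partial sums are constant
   once they include it. *)
move=> m; exists (m ord0).+1 => K lt_mK; rewrite !mfps_coef_sum.
have [pi0 pi0P] := exists_unique_descent_face m.
transitivity ([forall j : 'I_n, (m (lift ord0 j) <= m ord0)%N]%:R : int).
  under eq_bigr do rewrite mfps_coef_qnum_prod.
  rewrite (bigD1 (Ordinal lt_mK)) //= eqxx big1 ?addr0 // => k.
  by rewrite -val_eqE /= eq_sym => /negPf ->.
under [RHS]eq_bigr => pi _.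
  rewrite prod_Des; under [X in _ / X]eq_bigr do rewrite zprod_monom.
  rewrite (face_seriesE pi (descent pi)) /= pi0P; over.
by rewrite (bigD1 pi0) //= eqxx big1 ?addr0 // => pi /negPf ->.
Qed.
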